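(* For all integers $n, m \geq 1$, $$\int_0^\infty \phi_n(-x)\,\phi_m(-x)\, e^{-2x}\, \frac{dx}{x} = (-1)^{n-1}\, \frac{2^{n+m}-1}{n+m}\, B_{n+m}.$$
   Context: The exponential polynomials (single-variable Bell polynomials) $\phi_n(x)$, $n = 0,1,2,\ldots$, are the polynomials of degree $n$ defined by $$\left(x\frac{d}{dx}\right)^n e^x = \phi_n(x)\, e^x = \sum_{k=0}^\infty \frac{k^n x^k}{k!}$$ (with $0^0=1$), where $\left(x\frac{d}{dx}\right)^n$ denotes the $n$-th iterate of the operator $f \mapsto x f'(x)$. Equivalently, $\phi_n(x) = \sum_{k=0}^n \left\{{n \atop k}\right\} x^k$, where $\left\{{n \atop k}\right\}$ are the Stirling numbers of the second kind. For example $\phi_0(x)=1$, $\phi_1(x)=x$, $\phi_2(x)=x^2+x$. $B_k$, $k=0,1,2,\ldots$, denote the Bernoulli numbers, $\frac{t}{e^t-1} = \sum_{k\ge 0} B_k \frac{t^k}{k!}$. *)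

(* Defs.v *)
(* Stdlib real numbers with Coquelicot *)
From Stdlib Require Import Reals Lra Lia Factorial.
From Coquelicot Require Import Coquelicot.
Open Scope R_scope.

Definition xD (f : R -> R) : R -> R := fun x => x * Derive f x.

(* phi_n, as determined by (x d/dx)^n e^x = phi_n(x) e^x; it is a polynomial
   function of degree n, see [phi_stirling2]. *)
Definition phi (n : nat) (x : R) : R := Nat.iter n xD exp x / exp x.

(* The exponential generating function t / (e^t - 1) = sum_k B_k t^k / k! near
   t = 0. The point t = 0 itself is left out, where the quotient is not defined.
   By uniqueness of power series coefficients this determines B; existence is
   [bernoulli_numbers_exist]. *)
Definition bernoulli_numbers (B : nat -> R) : Prop :=
  exists r : R, 0 < r /\
    forall t : R, 0 < Rabs t < r ->
      is_series (fun k : nat => B k * t ^ k / INR (fact k)) (t / (exp t - 1)).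

Lemma phi_spec (n : nat) (x : R) : Nat.iter n xD exp x = phi n x * exp x.
Proof. unfold phi; field; apply Rgt_not_eq, exp_pos. Qed.

Fixpoint stirling2 (n k : nat) : nat :=
  match n, k with
  | O, O => 1
  | O, S _ => 0
  | S _, O => 0
  | S n', S k' => S k' * stirling2 n' (S k') + stirling2 n' k'
  end.

Lemma stirling2_small (n k : nat) : (n < k)%nat -> stirling2 n k = 0%nat.
Proof.
revert k; induction n as [|n IH]; intros [|k] H; try lia; [reflexivity|].
cbn [stirling2]; rewrite !IH by lia; lia.
Qed.

Lemma stirling2_diag (n : nat) : stirling2 n n = 1%nat.
Proof.
induction n as [|n IH]; [reflexivity|].
cbn [stirling2]; rewrite IH, stirling2_small by lia; lia.
Qed.

Lemma is_derive_poly (a : nat -> R) (n : nat) (x : R) :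
  is_derive (fun y => sum_f_R0 (fun k => a k * y ^ k) n) x
    (sum_f_R0 (fun k => a k * (INR k * x ^ pred k)) n).
Proof.
induction n as [|n IH]; cbn [sum_f_R0].
- auto_derive; [exact I | simpl; ring].
- apply (is_derive_plus (V := R_NormedModule)); [exact IH|].
  auto_derive; [exact I | cbn [pred]; rewrite S_INR; destruct n; simpl; ring].
Qed.

Lemma phi_stirling2 (n : nat) (x : R) :
  phi n x = sum_f_R0 (fun k => INR (stirling2 n k) * x ^ k) n.
Proof.
assert (H : Nat.iter n xD exp x =
            sum_f_R0 (fun k => INR (stirling2 n k) * x ^ k) n * exp x).
2:{ unfold phi; rewrite H; field; apply Rgt_not_eq, exp_pos. }
revert x; induction n as [|n IH]; intros x; [simpl; ring|].
change (x * Derive (Nat.iter n xD exp) x =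
  sum_f_R0 (fun k => INR (stirling2 (S n) k) * x ^ k) (S n) * exp x).
rewrite (Derive_ext _ _ x IH).
rewrite (is_derive_unique _ x
  (sum_f_R0 (fun k => INR (stirling2 n k) * (INR k * x ^ pred k)) n * exp x
   + sum_f_R0 (fun k => INR (stirling2 n k) * x ^ k) n * exp x)).
2:{ apply (is_derive_mult (K := R_AbsRing)
      (fun y => sum_f_R0 (fun k => INR (stirling2 n k) * y ^ k) n) exp).
    - apply is_derive_poly.
    - apply is_derive_exp.
    - intros u v; apply Rmult_comm. }
enough (E : sum_f_R0 (fun k => INR (stirling2 (S n) k) * x ^ k) (S n) =
  x * sum_f_R0 (fun k => INR (stirling2 n k) * (INR k * x ^ pred k)) n
  + x * sum_f_R0 (fun k => INR (stirling2 n k) * x ^ k) n).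
{ rewrite E; ring. }
rewrite decomp_sum by lia; cbn [pred stirling2].
rewrite (sum_eq _ (fun k => INR (stirling2 n (S k)) * (INR (S k) * x ^ S k)
                            + INR (stirling2 n k) * x ^ k * x) n).
2:{ intros k _; rewrite plus_INR, mult_INR; simpl (x ^ S k); ring. }
rewrite sum_plus, <- scal_sum; simpl (INR 0); rewrite Rmult_0_l, Rplus_0_l.
f_equal.
assert (T := decomp_sum
  (fun k => INR (stirling2 n k) * (INR k * x ^ k)) (S n) ltac:(lia)).
cbn [pred] in T; simpl (INR 0) in T.
rewrite Rmult_0_l, Rmult_0_r, Rplus_0_l in T; rewrite <- T, tech5.
rewrite stirling2_small by lia; simpl (INR 0); rewrite Rmult_0_l, Rplus_0_r.
rewrite scal_sum; apply sum_eq; intros [|k] _; [simpl; ring|].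
cbn [pred pow]; ring.
Qed.

(* bern_upto n k is B_k / k! for k <= n, obtained by inverting the power series
   of (e^t - 1) / t. *)
Fixpoint bern_upto (n : nat) : nat -> R :=
  match n with
  | O => fun _ => 1
  | S m => fun k =>
      if Nat.eqb k (S m)
      then - sum_f_R0 (fun j => bern_upto m j * / INR (fact (S (S m - j)))) m
      else bern_upto m k
  end.

Definition bern (k : nat) : R := bern_upto k k.

Lemma bern_upto_le (n k : nat) : (k <= n)%nat -> bern_upto n k = bern k.
Proof.
induction n as [|n IH]; intros H.
- replace k with 0%nat by lia; reflexivity.
- destruct (Nat.eq_dec k (S n)) as [->|N]; [reflexivity|].
  cbn [bern_upto]; rewrite (proj2 (Nat.eqb_neq k (S n)) N); apply IH; lia.
Qed.

Lemma bern_S (n : nat) :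
  bern (S n) = - sum_f_R0 (fun j => bern j * / INR (fact (S (S n - j)))) n.
Proof.
unfold bern at 1; cbn [bern_upto]; rewrite Nat.eqb_refl; f_equal.
apply sum_eq; intros j Hj; rewrite bern_upto_le by exact Hj; reflexivity.
Qed.

Lemma inv_fact_S_le (n : nat) : / INR (fact (S n)) <= (/ 2) ^ n.
Proof.
induction n as [|n IH]; [simpl; lra|].
rewrite (fact_simpl (S n)), mult_INR, Rinv_mult; cbn [pow].
apply Rmult_le_compat.
- left; apply Rinv_0_lt_compat, lt_0_INR; lia.
- left; apply Rinv_0_lt_compat, INR_fact_lt_0.
- apply Rinv_le_contravar; [lra|].
  rewrite !S_INR; generalize (pos_INR n); lra.
- exact IH.
Qed.

Lemma half_sum (n : nat) : sum_f_R0 (fun j => (/ 2) ^ (S n - j)) n <= 1.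
Proof.
induction n as [|n IH]; [simpl; lra|].
rewrite tech5; replace (S (S n) - S n)%nat with 1%nat by lia.
rewrite (sum_eq _ (fun j => (/ 2) ^ (S n - j) * / 2) n).
- rewrite <- scal_sum; simpl (_ ^ 1); lra.
- intros j Hj; replace (S (S n) - j)%nat with (S (S n - j)) by lia.
  cbn [pow]; ring.
Qed.

Lemma bern_bound (n : nat) : Rabs (bern n) <= 1.
Proof.
induction n as [n IH] using (well_founded_induction Wf_nat.lt_wf).
destruct n as [|n].
- unfold bern; simpl; rewrite Rabs_R1; lra.
- rewrite bern_S, Rabs_Ropp.
  eapply Rle_trans; [apply Rsum_abs|].
  eapply Rle_trans; [|apply (half_sum n)].
  apply sum_Rle; intros j Hj; rewrite Rabs_mult.
  rewrite <- (Rmult_1_l ((/ 2) ^ _)).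
  apply Rmult_le_compat; try apply Rabs_pos; [apply IH; lia|].
  rewrite Rabs_pos_eq; [apply inv_fact_S_le|].
  left; apply Rinv_0_lt_compat, INR_fact_lt_0.
Qed.

Lemma CV_radius_ge_1 (a : nat -> R) :
  (forall n, Rabs (a n) <= 1) -> Rbar_le 1 (CV_radius a).
Proof.
intros H; apply (proj1 (CV_radius_bounded a)); exists 1; intros n.
rewrite pow1, Rmult_1_r; apply H.
Qed.

Lemma PS_mult_bern (n : nat) :
  PS_mult bern (fun k => / INR (fact (S k))) n = if Nat.eqb n 0 then 1 else 0.
Proof.
unfold PS_mult; destruct n as [|n]; [unfold bern; simpl; field|].
rewrite tech5, bern_S, Nat.sub_diag; simpl (fact 1); simpl (INR 1).
cbn [Nat.eqb]; field.
Qed.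

Lemma bernoulli_numbers_exist : exists B : nat -> R, bernoulli_numbers B.
Proof.
exists (fun k => bern k * INR (fact k)); exists 1; split; [lra|].
intros t [Ht0 Ht1].
assert (t0 : t <> 0) by (intros ->; rewrite Rabs_R0 in Ht0; lra).
assert (e0 : exp t - 1 <> 0).
{ intros E; apply t0, exp_inv; rewrite exp_0; lra. }
set (e := fun k => / INR (fact (S k))).
assert (Cb : Rbar_lt (Rabs t) (CV_radius bern)).
{ eapply Rbar_lt_le_trans; [|apply CV_radius_ge_1, bern_bound]; exact Ht1. }
assert (Ce : Rbar_lt (Rabs t) (CV_radius e)).
{ eapply Rbar_lt_le_trans; [|apply CV_radius_ge_1]; [exact Ht1|].
  intros n; unfold e; rewrite Rabs_pos_eq.
  - eapply Rle_trans; [apply inv_fact_S_le|].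
    rewrite <- (pow1 n); apply pow_incr; lra.
  - left; apply Rinv_0_lt_compat, INR_fact_lt_0. }
assert (Pb := PSeries_correct _ _ (CV_radius_inside _ _ Cb)).
assert (Ee : PSeries e t = (exp t - 1) / t).
{ assert (X := is_pseries_unique _ _ _ (is_exp_Reals t)).
  rewrite PSeries_decr_1 in X by (eexists; apply is_exp_Reals).
  simpl (fact 0) in X; simpl (INR 1) in X.
  change (PS_decr_1 (fun n => / INR (fact n))) with e in X.
  rewrite <- X; field; exact t0. }
assert (M := PSeries_mult bern e t Cb Ce).
rewrite (PSeries_ext (PS_mult bern e) _ t PS_mult_bern), Ee in M.
rewrite (is_pseries_unique _ t 1) in M.
2:{ apply is_series_decr_1.
    apply (is_series_ext (fun _ => 0)).
    - intros k; cbn; unfold scal; simpl; unfold mult; simpl; ring.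
    - replace (plus _ _) with 0
        by (cbn; unfold plus, opp, scal; simpl; unfold mult, one; simpl; ring).
      apply (filterlim_ext (fun _ => 0)).
      + intros k; induction k as [|k IH];
          [rewrite sum_O | rewrite sum_Sn, <- IH; unfold plus; simpl; ring].
        reflexivity.
      + apply filterlim_const. }
replace (t / (exp t - 1)) with (PSeries bern t).
2:{ apply (Rmult_eq_reg_r ((exp t - 1) / t)).
    - rewrite <- M; field; split; assumption.
    - unfold Rdiv; apply Rmult_integral_contrapositive_currified;
        [assumption | apply Rinv_neq_0_compat; assumption]. }
eapply is_series_ext; [|exact Pb].
intros k; unfold scal; simpl; unfold mult; simpl; rewrite pow_n_pow.
field; apply INR_fact_neq_0.
Qed.

(* Main.v *)
Require Import Defs.
From Stdlib Require Import Reals Factorial Lra Lia FunctionalExtensionality.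
From Coquelicot Require Import Coquelicot.
Open Scope R_scope.

(** Put u_n(x) = phi_n(-x) e^(-x), so that u_(n+1) = x u_n' and the integral in
    question is I(n,m), the integral of u_n u_m / x over (0, oo).

    Integration by parts moves an index from one factor to the other: since
    u_(n+1) u_m / x = u_n' u_m = (u_n u_m)' - u_n u_(m+1) / x, and u_n u_m
    vanishes at infinity and, for n >= 1, at 0, one gets
    I(n+1, m) = - I(n, m+1) ([RInt_gen_by_parts]).  Hence only n = 1 matters,
    where u_1 = -x e^(-x), so that I(1, M) = - a_M for the moments a_M, the
    integrals of e^(-x) u_M.

    Formally sum_M a_M t^M / M! is the integral of exp (-2x - x (e^t - 1)), which
    is 1 / (1 + e^t), and 1 / (1 + e^t) is the difference of 1 / (e^t - 1) and
    2 / (e^(2t) - 1); this predicts a_M = (1 - 2^(M+1)) B_(M+1) / (M+1).  Rather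
    than justify exchanging sum and integral, the proof compares two copies of
    the recursion a_M + sum_(j <= M) C(M,j) a_j = [M = 0], which says that
    (1 + e^t) times the generating function is 1:
    - the numbers on the right satisfy it, by multiplying the power series of
      t / (e^t + 1) by e^t + 1 ([logistic_coeff_rec]);
    - the integrals satisfy it because u_M' = - sum_(j <= M) C(M,j) u_j
      ([is_derive_iter_xD_exp]), so that the left-hand side is, up to sign, the
      integral of the exact derivative (e^(-x) u_M)'.
    The recursion also exhibits each moment integrand as a combination of a
    total derivative and earlier ones, so convergence comes with the value
    ([RInt_gen_moment]). *)

(** * Derivatives of the iterates of x d/dx on exp *)

Lemma binomial_0_r (n : nat) : Binomial.C n 0 = 1.
Proof.
unfold Binomial.C; rewrite Nat.sub_0_r; simpl; field; apply INR_fact_neq_0.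
Qed.

Lemma binomial_diag (n : nat) : Binomial.C n n = 1.
Proof.
unfold Binomial.C; rewrite Nat.sub_diag; simpl; field; apply INR_fact_neq_0.
Qed.

(** Pascal's rule in the form of one step of the binomial expansion of
    (1 + theta)^n, where theta shifts the index of f. *)
Lemma sum_binomial_shift (f : nat -> R) (n : nat) :
  sum_f_R0 (fun j => Binomial.C n j * (f j + f (S j))) n =
  sum_f_R0 (fun j => Binomial.C (S n) j * f j) (S n).
Proof.
rewrite (decomp_sum _ (S n)) by lia; cbn [pred].
rewrite (sum_eq _ (fun j => Binomial.C n j * f j + Binomial.C n j * f (S j)))
  by (intros; ring).
rewrite sum_plus.
destruct n as [|n].
- simpl; unfold Binomial.C; simpl; field.
- rewrite (decomp_sum (fun j => Binomial.C (S n) j * f j)) by lia; cbn [pred].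
  rewrite (tech5 (fun j => Binomial.C (S n) j * f (S j)) n).
  rewrite (tech5 (fun j => Binomial.C (S (S n)) (S j) * f (S j)) n).
  rewrite (sum_eq (fun j => Binomial.C (S (S n)) (S j) * f (S j))
    (fun j => Binomial.C (S n) (S j) * f (S j) + Binomial.C (S n) j * f (S j))).
  2:{ intros j Hj; rewrite <- (pascal (S n) j) by lia; ring. }
  rewrite sum_plus.
  rewrite !binomial_0_r, !binomial_diag; ring.
Qed.

Lemma is_derive_sum_f_R0 (f : nat -> R -> R) (d : nat -> R) (n : nat) (x : R) :
  (forall j, (j <= n)%nat -> is_derive (f j) x (d j)) ->
  is_derive (fun y => sum_f_R0 (fun j => f j y) n) x (sum_f_R0 d n).
Proof.
induction n as [|n IH]; intros H; cbn [sum_f_R0]; [apply H; lia|].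
apply (is_derive_plus (V := R_NormedModule)); [apply IH|apply H]; auto.
Qed.

Lemma iter_xD_S (n : nat) (f : R -> R) (x : R) :
  Nat.iter (S n) xD f x = x * Derive (Nat.iter n xD f) x.
Proof. reflexivity. Qed.

(** With D = d/dx and theta = x D, the product rule gives D theta = (theta + 1) D,
    hence D theta^n = (theta + 1)^n D.  Applied to exp, which D fixes, this is
    the binomial sum.  The induction also yields the differentiability that
    turns [Derive] into an actual derivative at the next step. *)
Lemma is_derive_iter_xD_exp (n : nat) (x : R) :
  is_derive (Nat.iter n xD exp) x
    (sum_f_R0 (fun j => Binomial.C n j * Nat.iter j xD exp x) n).
Proof.
revert x; induction n as [n IH] using (well_founded_induction Wf_nat.lt_wf).
destruct n as [|n]; intros x.
- simpl; replace (_ * _) with (exp x); [apply is_derive_exp|].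
  unfold Binomial.C; simpl; field.
- apply (is_derive_ext
    (fun y => y * sum_f_R0 (fun j => Binomial.C n j * Nat.iter j xD exp y) n)).
  { intros y; rewrite iter_xD_S; f_equal; symmetry.
    apply is_derive_unique, IH; lia. }
  rewrite <- sum_binomial_shift.
  rewrite (sum_eq _ (fun j => Binomial.C n j * Nat.iter j xD exp x
     + (Binomial.C n j * Derive (Nat.iter j xD exp) x) * x)).
  2:{ intros j _; rewrite iter_xD_S; ring. }
  rewrite sum_plus, <- scal_sum.
  rewrite <- (Rmult_1_l (sum_f_R0 (fun j => Binomial.C n j * _) n)) at 1.
  apply (is_derive_mult (K := R_AbsRing) (fun y => y)
    (fun y => sum_f_R0 (fun j => Binomial.C n j * Nat.iter j xD exp y) n)).
  + apply (is_derive_id (K := R_AbsRing)).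
  + apply is_derive_sum_f_R0; intros j Hj.
    apply (is_derive_scal (Nat.iter j xD exp)).
    apply Derive_correct; eexists; apply IH; lia.
  + intros u v; apply Rmult_comm.
Qed.

(** * Decay at infinity *)

Lemma is_lim_pow_mul_exp_m (k : nat) :
  is_lim (fun y => y ^ k * exp y) m_infty 0.
Proof.
induction k as [|k IH].
- apply (is_lim_ext exp); [intros y; simpl; ring | apply is_lim_exp_m].
- (* Half of the exponential absorbs one factor y, the other half the rest. *)
  assert (Hh : forall f, is_lim f m_infty 0 ->
                 is_lim (fun y => f (/ 2 * y + 0)) m_infty 0).
  { intros f Hf; apply is_lim_comp_lin; [|lra].
    replace (Rbar_plus (Rbar_mult (/ 2) m_infty) 0) with m_infty; [exact Hf|].
    unfold Rbar_mult, Rbar_mult'; destruct (Rle_dec 0 (/ 2)) as [H|]; [|lra].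
    destruct (Rle_lt_or_eq_dec _ _ H); [reflexivity|lra]. }
  assert (L := is_lim_scal_l _ (2 ^ S k) _ _
    (is_lim_mult _ _ _ _ _ (Hh _ is_lim_mul_exp_m) (Hh _ IH) I)).
  simpl in L; rewrite !Rmult_0_r in L.
  eapply is_lim_ext; [|exact L].
  intros y; cbv beta; rewrite !Rplus_0_r.
  replace (exp y) with (exp (/ 2 * y) * exp (/ 2 * y))
    by (rewrite <- exp_plus; f_equal; field).
  replace (y ^ S k) with (2 ^ S k * (/ 2 * y) ^ S k)
    by (rewrite <- Rpow_mult_distr; f_equal; field).
  simpl; ring.
Qed.

Lemma is_lim_poly_mul_exp_m (a : nat -> R) (n : nat) :
  is_lim (fun y => sum_f_R0 (fun k => a k * y ^ k) n * exp y) m_infty 0.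
Proof.
assert (T : forall k, is_lim (fun y => a k * y ^ k * exp y) m_infty 0).
{ intros k; assert (L := is_lim_scal_l _ (a k) _ _ (is_lim_pow_mul_exp_m k)).
  simpl in L; rewrite Rmult_0_r in L.
  eapply is_lim_ext; [|exact L]; intros y; cbv beta; ring. }
induction n as [|n IH]; [apply T|].
assert (L := is_lim_plus' _ _ _ _ _ IH (T (S n))); rewrite Rplus_0_l in L.
eapply is_lim_ext; [|exact L]; intros y; cbn [sum_f_R0]; ring.
Qed.

(** * The functions u_n and their derivatives *)

(** This is phi_n(-x) e^(-x), in the form on which x d/dx acts by shifting n. *)
Definition u (n : nat) (x : R) : R := Nat.iter n xD exp (- x).

(** The derivative of u_n as a binomial sum, avoiding the quotient u_(n+1) / x,
    which has no value at 0. *)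
Definition du (n : nat) (x : R) : R :=
  - sum_f_R0 (fun j => Binomial.C n j * u j x) n.

Lemma is_derive_u (n : nat) (x : R) : is_derive (u n) x (du n x).
Proof.
unfold du; rewrite <- (Rmult_1_l (sum_f_R0 _ _)), Ropp_mult_distr_l.
apply (is_derive_comp (Nat.iter n xD exp) Ropp).
- apply is_derive_iter_xD_exp.
- auto_derive; [exact I | ring].
Qed.

Lemma u_S (n : nat) (x : R) : u (S n) x = x * du n x.
Proof.
unfold u; rewrite iter_xD_S.
rewrite (is_derive_unique _ _ _ (is_derive_iter_xD_exp n (- x))).
unfold du, u; ring.
Qed.

Lemma u_at_0 (n : nat) : u n 0 = if Nat.eqb n 0 then 1 else 0.
Proof.
destruct n as [|n]; [unfold u; simpl; rewrite Ropp_0; apply exp_0|].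
rewrite u_S; simpl; ring.
Qed.

Lemma is_lim_u (n : nat) : is_lim (u n) p_infty 0.
Proof.
assert (L := is_lim_poly_mul_exp_m (fun k => INR (stirling2 n k)) n).
apply (is_lim_ext (fun x => (fun y =>
  sum_f_R0 (fun k => INR (stirling2 n k) * y ^ k) n * exp y) (- x))).
- intros x; cbv beta; unfold u; rewrite phi_spec, phi_stirling2; reflexivity.
- apply (is_lim_comp _ Ropp p_infty 0 m_infty L).
  + apply (is_lim_opp (fun y => y) p_infty p_infty), is_lim_id.
  + exists 0; intros; discriminate.
Qed.

Lemma continuous_u (n : nat) (x : R) : continuous (u n) x.
Proof.
apply (ex_derive_continuous (V := R_NormedModule)); eexists; apply is_derive_u.
Qed.

Lemma continuous_du (n : nat) (x : R) : continuous (du n) x.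
Proof.
apply (ex_derive_continuous (V := R_NormedModule)).
apply (ex_derive_opp (V := R_NormedModule)
  (fun x => sum_f_R0 (fun j => Binomial.C n j * u j x) n)).
eexists; apply is_derive_sum_f_R0; intros j _.
apply is_derive_scal, is_derive_u.
Qed.

(** * Integrals over the half line *)

Notation is_RInt_half_line f l :=
  (is_RInt_gen f (at_right 0) (Rbar_locally p_infty) l).

Lemma is_RInt_half_line_ext (f g : R -> R) (l : R) :
  (forall x, 0 < x -> f x = g x) ->
  is_RInt_half_line f l -> is_RInt_half_line g l.
Proof.
intros H; apply is_RInt_gen_ext.
apply (Filter_prod _ _ _ (fun a => 0 < a) (fun b => 0 < b)).
- exists (mkposreal 1 Rlt_0_1); intros y _ Hy; exact Hy.
- exists 0; intros y Hy; exact Hy.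
- intros a b Ha Hb x [Hx _]; apply H; simpl in Hx.
  eapply Rlt_trans; [|exact Hx]; apply Rmin_glb_lt; assumption.
Qed.

Lemma is_RInt_half_line_derive (F f : R -> R) :
  (forall x, is_derive F x (f x)) -> (forall x, continuous f x) ->
  is_lim F p_infty 0 -> is_RInt_half_line f (- F 0).
Proof.
intros HF Hf HL.
assert (E : Derive F = f).
{ apply functional_extensionality; intros x; apply is_derive_unique, HF. }
rewrite <- E, <- (Rminus_0_l (F 0)).
apply is_RInt_gen_Derive; try apply filter_forall.
- intros ab x _; eexists; apply HF.
- intros ab x _; rewrite E; apply Hf.
- eapply filterlim_filter_le_1; [apply filter_le_within|].
  apply (ex_derive_continuous (V := R_NormedModule)); eexists; apply HF.
- exact HL.
Qed.

Lemma is_RInt_half_line_plus (f g : R -> R) (l k : R) :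
  is_RInt_half_line f l -> is_RInt_half_line g k ->
  is_RInt_half_line (fun x => f x + g x) (l + k).
Proof. exact (is_RInt_gen_plus (V := R_NormedModule) f g l k). Qed.

Lemma is_RInt_half_line_scal (f : R -> R) (k l : R) :
  is_RInt_half_line f l -> is_RInt_half_line (fun x => k * f x) (k * l).
Proof. exact (is_RInt_gen_scal (V := R_NormedModule) f k l). Qed.

Lemma is_RInt_half_line_sum (f : nat -> R -> R) (l : nat -> R) (n : nat) :
  (forall j, (j <= n)%nat -> is_RInt_half_line (f j) (l j)) ->
  is_RInt_half_line (fun x => sum_f_R0 (fun j => f j x) n) (sum_f_R0 l n).
Proof.
induction n as [|n IH]; intros H; cbn [sum_f_R0]; [apply H; lia|].
apply is_RInt_half_line_plus; [apply IH|apply H]; auto.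
Qed.

Lemma RInt_gen_total_derivative (n m : nat) :
  is_RInt_half_line (fun x => du n x * u m x + u n x * du m x)
    (- (u n 0 * u m 0)).
Proof.
apply (is_RInt_half_line_derive (fun x => u n x * u m x)).
- intros x; apply (is_derive_mult (K := R_AbsRing) (u n) (u m));
    [apply is_derive_u | apply is_derive_u | intros; apply Rmult_comm].
- intros x; apply (continuous_plus (V := R_NormedModule));
    apply (continuous_mult (K := R_AbsRing));
    first [apply continuous_u | apply continuous_du].
- assert (L := is_lim_mult _ _ _ _ _ (is_lim_u n) (is_lim_u m) I).
  simpl in L; rewrite Rmult_0_r in L; exact L.
Qed.

(** The operator x d/dx is skew-symmetric for the measure dx / x; the boundary
    term at 0 vanishes because u_n has the factor x when n >= 1. *)
Lemma RInt_gen_by_parts (n m : nat) (l : R) : (1 <= n)%nat ->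
  is_RInt_half_line (fun x => u n x * u (S m) x / x) l ->
  is_RInt_half_line (fun x => u (S n) x * u m x / x) (- l).
Proof.
intros Hn H.
assert (D := RInt_gen_total_derivative n m).
rewrite (u_at_0 n), (proj2 (Nat.eqb_neq n 0)), Rmult_0_l in D by lia.
replace (- l) with (- 0 + -1 * l) by ring.
eapply is_RInt_half_line_ext;
  [|apply (is_RInt_half_line_plus _ _ _ _ D (is_RInt_half_line_scal _ (-1) _ H))].
intros x Hx; cbv beta; rewrite !u_S; field; lra.
Qed.

(** * The coefficients of 1 / (1 + e^t) *)

(** In 1 / (1 + e^t) = sum_j a_j t^j / j!, this is a_j, with one index and one
    factor fewer than in the Bernoulli series because of the division by t. *)
Definition logistic_coeff (B : nat -> R) (j : nat) : R :=
  (1 - 2 ^ S j) / INR (S j) * B (S j).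

(** A point beyond t still inside the interval of convergence gives the strict
    inequality that products of power series require. *)
Lemma CV_radius_gt (a : nat -> R) (r t : R) :
  (forall s, Rabs s < r -> ex_pseries a s) -> Rabs t < r ->
  Rbar_lt (Rabs t) (CV_radius a).
Proof.
intros H Ht.
set (s := (Rabs t + r) / 2).
assert (Hs : Rabs s = s).
{ apply Rabs_pos_eq; unfold s; generalize (Rabs_pos t); lra. }
apply Rbar_lt_le_trans with (Rabs s); [rewrite Hs; unfold s; simpl; lra|].
apply Rbar_not_lt_le; intros N; apply (CV_disk_outside _ _ N).
assert (X : ex_pseries a s) by (apply H; rewrite Hs; unfold s; lra).
eapply is_lim_seq_ext; [|apply (ex_series_lim_0 _ X)].
intros k; cbv beta; unfold scal; simpl; unfold mult; simpl.
rewrite pow_n_pow; ring.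
Qed.

Lemma is_pseries_coeff_unique (a b : nat -> R) (f : R -> R) (r : R) (n : nat) :
  0 < r -> (forall t, Rabs t < r -> is_pseries a t (f t)) ->
  (forall t, Rabs t < r -> is_pseries b t (f t)) -> a n = b n.
Proof.
intros Hr Ha Hb.
apply PSeries_ext_recip.
- rewrite <- Rabs_R0; apply (CV_radius_gt a r);
    [intros s Hs; eexists; apply Ha, Hs | rewrite Rabs_R0; exact Hr].
- rewrite <- Rabs_R0; apply (CV_radius_gt b r);
    [intros s Hs; eexists; apply Hb, Hs | rewrite Rabs_R0; exact Hr].
- exists (mkposreal r Hr); intros t Ht.
  assert (Ht' : Rabs t < r).
  { replace t with (minus t 0) by (unfold minus, plus, opp; simpl; ring).
    exact Ht. }
  rewrite (is_pseries_unique _ _ _ (Ha t Ht')).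
  rewrite (is_pseries_unique _ _ _ (Hb t Ht')); reflexivity.
Qed.

Lemma is_pseries_exp_series (a : nat -> R) (t l : R) :
  is_series (fun k => a k * t ^ k / INR (fact k)) l ->
  is_pseries (fun k => a k / INR (fact k)) t l.
Proof.
apply is_series_ext; intros k; unfold scal; simpl; unfold mult; simpl.
symmetry; rewrite pow_n_pow; unfold Rdiv; ring.
Qed.

(** The partial fractions t / (e^t - 1) - 2t / (e^(2t) - 1) = t / (e^t + 1). *)
Lemma is_pseries_logistic (B : nat -> R) : bernoulli_numbers B ->
  exists r, 0 < r /\ forall t, Rabs t < r ->
    is_pseries (fun k => (1 - 2 ^ k) * B k / INR (fact k)) t (t / (exp t + 1)).
Proof.
intros [r [Hr HB]]; exists (r / 2); split; [lra|]; intros t Ht.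
destruct (Req_dec t 0) as [->|t0].
- replace (0 / (exp 0 + 1)) with ((1 - 2 ^ 0) * B 0%nat / INR (fact 0))
    by (simpl; unfold Rdiv; ring).
  apply (is_pseries_0 (K := R_AbsRing) (V := R_NormedModule)
    (fun k => (1 - 2 ^ k) * B k / INR (fact k))).
- assert (Ht1 : 0 < Rabs t) by (apply Rabs_pos_lt, t0).
  assert (S1 := HB t ltac:(lra)).
  assert (S2 := HB (2 * t)
    ltac:(rewrite Rabs_mult, (Rabs_pos_eq 2) by lra; lra)).
  apply is_pseries_exp_series.
  assert (D := is_series_minus _ _ _ _ S1 S2).
  assert (E2 : exp (2 * t) = exp t * exp t)
    by (rewrite <- exp_plus; f_equal; ring).
  assert (e0 : exp t - 1 <> 0).
  { intros E; apply t0, exp_inv; rewrite exp_0; lra. }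
  assert (e1 : exp t + 1 <> 0) by (generalize (exp_pos t); lra).
  replace (t / (exp t + 1)) with
    (plus (t / (exp t - 1)) (opp (2 * t / (exp (2 * t) - 1)))).
  + eapply is_series_ext; [|exact D].
    intros k; unfold plus, opp; simpl; rewrite Rpow_mult_distr.
    unfold Rdiv; ring.
  + unfold plus, opp; simpl; rewrite E2.
    replace (exp t * exp t - 1) with ((exp t - 1) * (exp t + 1)) by ring.
    field; split; assumption.
Qed.

(** Compare the coefficients of t^(M+1) in (t / (e^t + 1)) (e^t + 1) = t; having t
    rather than 1 on the right avoids dividing power series by t. *)
Lemma logistic_coeff_rec (B : nat -> R) (M : nat) : bernoulli_numbers B ->
  logistic_coeff B M + sum_f_R0 (fun j => Binomial.C M j * logistic_coeff B j) M
  = if Nat.eqb M 0 then 1 else 0.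
Proof.
intros HB; destruct (is_pseries_logistic B HB) as [r [Hr Hc]].
set (c := fun k => (1 - 2 ^ k) * B k / INR (fact k)) in Hc.
set (e := fun k => / INR (fact k)).
assert (H : sum_f_R0 (fun k => c k * e (S M - k)%nat) (S M) + c (S M) =
            if Nat.eqb M 0 then 1 else 0).
{ change (PS_plus (PS_mult c e) c (S M) =
    (fun k => if Nat.eqb k 1 then 1 else 0) (S M)).
  apply (is_pseries_coeff_unique _
    (fun k => if Nat.eqb k 1 then 1 else 0) (fun t => t) r); [exact Hr| |].
  - intros t Ht.
    replace t with (plus (t / (exp t + 1) * exp t) (t / (exp t + 1))) at 2.
    2:{ unfold plus; simpl; field; generalize (exp_pos t); lra. }
    apply (is_pseries_plus (V := R_NormedModule)); [|apply Hc, Ht].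
    apply is_pseries_mult;
      [apply Hc, Ht | apply is_exp_Reals
      | apply (CV_radius_gt c r); [|exact Ht]
      | apply (CV_radius_gt e (Rabs t + 1)); [|lra]].
    + intros s Hs; eexists; apply Hc, Hs.
    + intros s _; eexists; apply is_exp_Reals.
  - intros t _.
    (* The partial sums of the series with single coefficient 1 at t^1 are
       constant from index 1 on. *)
    apply (filterlim_ext_loc (fun _ => t)); [|apply filterlim_const].
    exists 1%nat; intros k Hk; induction Hk as [|k Hk IH].
    + rewrite sum_Sn, sum_O; unfold plus, scal; simpl; unfold mult, one; simpl.
      unfold mult, one; simpl; ring.
    + rewrite sum_Sn, <- IH; destruct k as [|k]; [lia|].
      unfold plus, scal; simpl; unfold mult; simpl; ring. }
rewrite (decomp_sum _ (S M)) in H by lia; cbn [pred] in H.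
(* The constant term is 1 - 2^0 = 0, so the sum may start at index 1. *)
replace (c 0%nat) with 0 in H by (unfold c; simpl; unfold Rdiv; ring).
rewrite Rmult_0_l, Rplus_0_l in H.
rewrite (sum_eq _ (fun j => c (S j) * e (S M - S j)%nat * INR (fact M))).
2:{ intros j Hj; unfold logistic_coeff, c, e, Binomial.C.
    rewrite Nat.sub_succ, (fact_simpl j), mult_INR.
    field; repeat split; try apply INR_fact_neq_0; apply not_0_INR; lia. }
rewrite <- scal_sum.
replace (logistic_coeff B M) with (INR (fact M) * c (S M)).
2:{ unfold logistic_coeff, c; rewrite (fact_simpl M), mult_INR.
    field; repeat split; try apply INR_fact_neq_0; apply not_0_INR; lia. }
rewrite Rplus_comm, <- Rmult_plus_distr_l.
transitivity (INR (fact M) * (if Nat.eqb M 0 then 1 else 0)).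
- f_equal; exact H.
- destruct M; simpl; ring.
Qed.

(** * The moments and the theorem *)

(** Pointwise, - 2 u_0 u_M = (u_0 u_M)' + sum_(j < M) C(M,j) u_0 u_j, the two
    copies of u_0 u_M coming from u_0' and from the term j = M of u_M'.  The right
    side is an exact derivative plus earlier moment integrands, so strong
    induction gives convergence and value together. *)
Lemma RInt_gen_moment (B : nat -> R) (M : nat) : bernoulli_numbers B ->
  is_RInt_half_line (fun x => u 0 x * u M x) (logistic_coeff B M).
Proof.
intros HB.
induction M as [M IH] using (well_founded_induction Wf_nat.lt_wf).
assert (Rec := logistic_coeff_rec B M HB).
assert (D := RInt_gen_total_derivative 0 M).
rewrite !u_at_0, Rmult_1_l in D; rewrite <- Rec in D; clear Rec.
destruct M as [|K].
- replace (logistic_coeff B 0) with (- / 2 * (- (logistic_coeff B 0 +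
      sum_f_R0 (fun j => Binomial.C 0 j * logistic_coeff B j) 0))).
  2:{ unfold Binomial.C; simpl; field. }
  eapply is_RInt_half_line_ext; [|apply (is_RInt_half_line_scal _ _ _ D)].
  intros x _; unfold du, Binomial.C; simpl; field.
- assert (S1 := is_RInt_half_line_sum
    (fun j x => Binomial.C (S K) j * (u 0 x * u j x)) _ K
    (fun j Hj => is_RInt_half_line_scal _ _ _ (IH j ltac:(lia)))).
  assert (P := is_RInt_half_line_scal _ (- / 2) _
    (is_RInt_half_line_plus _ _ _ _ D S1)).
  rewrite tech5, binomial_diag in P.
  match type of P with is_RInt_gen _ _ _ ?l =>
    replace (logistic_coeff B (S K)) with l by field end.
  eapply is_RInt_half_line_ext; [|exact P].
  intros x _; cbv beta.
  rewrite (sum_eq _ (fun j => Binomial.C (S K) j * u j x * u 0 x))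
    by (intros; ring).
  rewrite <- scal_sum; unfold du; rewrite tech5, binomial_diag.
  simpl (sum_f_R0 _ 0); rewrite binomial_0_r; field.
Qed.

Theorem proposition5 (B : nat -> R) (hB : bernoulli_numbers B)
  (n m : nat) (hn : (1 <= n)%nat) (hm : (1 <= m)%nat) :
  is_RInt_gen (fun x : R => phi n (- x) * phi m (- x) * exp (- 2 * x) / x)
    (at_right 0) (Rbar_locally p_infty)
    ((- 1) ^ (n - 1) * ((2 ^ (n + m) - 1) / INR (n + m)) * B (n + m)%nat).
Proof.
destruct n as [|k]; [lia|]; clear hn hm.
replace (_ * B (S k + m)%nat) with ((- 1) ^ k * - logistic_coeff B (m + k)).
2:{ unfold logistic_coeff; rewrite Nat.sub_succ, Nat.sub_0_r.
    replace (S k + m)%nat with (S (m + k)) by lia.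
    field; apply not_0_INR; lia. }
apply (is_RInt_half_line_ext (fun x => u (S k) x * u m x / x)).
{ intros x _; unfold u; rewrite !phi_spec.
  replace (- 2 * x) with (- x + - x) by ring; rewrite exp_plus.
  unfold Rdiv; ring. }
revert m; induction k as [|k IH]; intros m.
- rewrite Nat.add_0_r.
  replace (_ ^ 0 * - _) with (-1 * logistic_coeff B m) by (simpl; ring).
  eapply is_RInt_half_line_ext;
    [|apply (is_RInt_half_line_scal _ (-1) _ (RInt_gen_moment B m hB))].
  intros x Hx; cbv beta; rewrite (u_S 0); unfold du, Binomial.C; simpl; field; lra.
- replace ((- 1) ^ S k * - logistic_coeff B (m + S k)) with
    (- ((- 1) ^ k * - logistic_coeff B (S m + k))).
  2:{ replace (m + S k)%nat with (S m + k)%nat by lia; simpl pow; ring. }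
  apply RInt_gen_by_parts; [lia | apply IH].
Qed.
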